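(* Let $k$ be an algebraically closed field of characteristic $p>0$, let $(\mathfrak{g},[p])$ be a finite-dimensional $p$-trivial restricted Lie algebra over $k$ (i.e. $x^{[p]}=0$ for all $x\in\mathfrak{g}$), and let $M$ be a finite-dimensional $U_0(\mathfrak{g})$-module of constant rank. Then: (1) If $\dim_k\mathrm{Rad}(M)\le\dim_k\mathfrak{g}-1$, then $M$ has the equal images property. (2) If $\dim_k M/\mathrm{Soc}(M)\le\dim_k\mathfrak{g}-1$, then $M$ has the equal kernels property. (3) If $\max\{\dim_k\mathrm{Rad}(M),\dim_k M/\mathrm{Soc}(M)\}\le\dim_k\mathfrak{g}-1$, then $M$ is trivial. (4) If $\dim_k M\le\dim_k\mathfrak{g}$, then $M$ is trivial.
   Context: $U_0(\mathfrak{g})=U(\mathfrak{g})/(\{x^p-x^{[p]} : x\in\mathfrak{g}\})$ is the restricted enveloping algebra. $\mathrm{Rad}(M)$ and $\mathrm{Soc}(M)$ are the radical and socle of the $U_0(\mathfrak{g})$-module $M$. For $x\in\mathfrak{g}$, $x_M:M\to M$ is the operator $m\mapsto x.m$. For $p$-trivial $\mathfrak{g}$: $M$ has constant rank if $\mathrm{rk}(x_M)=\mathrm{rk}(y_M)$ for all $x,y\in\mathfrak{g}\setminus\{0\}$; $M$ has the equal images property (resp. equal kernels property) if $\mathrm{im}\,x_M^j=\mathrm{im}\,y_M^j$ (resp. $\ker x_M^j=\ker y_M^j$) for all $x,y\in\mathfrak{g}\setminus\{0\}$ and $j\in\{1,\ldots,p-1\}$. $M$ is trivial if $\mathfrak{g}.M=(0)$.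 *)

(* Defs.v *)
From HB Require Import structures.
From mathcomp Require Import all_boot all_order all_algebra.
From mathcomp Require Import generic_quotient ring_quotient.
From mathcomp Require Import boolp classical_sets.
From mathcomp Require Import monalg.

Set Implicit Arguments.
Unset Strict Implicit.
Unset Printing Implicit Defensive.

Import GRing.Theory.
Local Open Scope ring_scope.

(* Finite-dimensional restricted Lie algebras. In [ppowD], the s_i(x, y) are
   Jacobson's polynomials: i s_i(x, y) is the coefficient of t^(i-1) in
   ad(t x + y)^(p-1) (x).  The identity in t has degree at most p - 2, so over a
   field of characteristic p it determines s_1, .., s_(p-1) even though t
   ranges over scalars instead of being an indeterminate. *)
Record restrictedLieAlgebra (k : fieldType) (p : nat)
    (charkp : p \in [pchar k]) := RestrictedLieAlgebra {
  rla_sort :> vectType k;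
  bracket : rla_sort -> rla_sort -> rla_sort;
  bracket_linearl : forall y, linear (bracket^~ y);
  bracket_linearr : forall x, linear (bracket x);
  bracketxx : forall x, bracket x x = 0;
  jacobi : forall x y z,
    bracket x (bracket y z) + bracket y (bracket z x) + bracket z (bracket x y)
    = 0;
  ppow : rla_sort -> rla_sort;
  ppow_ad : forall x y, bracket (ppow x) y = iter p (bracket x) y;
  ppowZ : forall (a : k) x, ppow (a *: x) = a ^+ p *: ppow x;
  ppowD : exists s : nat -> rla_sort -> rla_sort -> rla_sort,
    (forall x y (t : k), iter p.-1 (bracket (t *: x + y)) x
       = \sum_(1 <= i < p) (i%:R * t ^+ i.-1) *: s i x y) /\
    (forall x y, ppow (x + y)
       = ppow x + ppow y + \sum_(1 <= i < p) s i x y)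
}.

Definition p_trivial (k : fieldType) (p : nat) (charkp : p \in [pchar k])
    (g : restrictedLieAlgebra charkp) :=
  forall x : g, ppow x = 0.

(* Quotient of a k-algebra by the two-sided ideal generated by a subset. *)
Section AlgebraQuotient.
Variables (k : fieldType) (A : lalgType k) (S : set A).

Inductive ideal_gen : A -> Prop :=
| ideal_gen_mem x : S x -> ideal_gen x
| ideal_gen0 : ideal_gen 0
| ideal_genD x y : ideal_gen x -> ideal_gen y -> ideal_gen (x + y)
| ideal_genMl a x : ideal_gen x -> ideal_gen (a * x)
| ideal_genMr x a : ideal_gen x -> ideal_gen (x * a).

Definition idealb : {pred A} := [pred x | `[< ideal_gen x >]].

Lemma idealbP x : reflect (ideal_gen x) (x \in idealb).
Proof. exact: asboolP. Qed.

Fact idealb_zmod_closed : zmod_closed idealb.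
Proof.
split=> [|x y /idealbP Ix /idealbP Iy]; apply/idealbP; first exact: ideal_gen0.
by rewrite -mulN1r; apply: ideal_genD => //; apply: ideal_genMl.
Qed.

HB.instance Definition _ := GRing.isZmodClosed.Build A idealb idealb_zmod_closed.

Definition algquot := Quotient.quot idealb.
HB.instance Definition _ := GRing.Zmodule.on algquot.

Definition qpi (x : A) : algquot := (\pi_algquot x)%qT.

Lemma qpi_eq x y : qpi x = qpi y <-> ideal_gen (x - y).
Proof.
rewrite (rwP (idealbP _)) /qpi; split=> [/eqP|H]; last apply/eqP;
  by rewrite eqmodE.
Qed.

Lemma qpiK (x : algquot) : qpi (repr x) = x. Proof. exact: reprK. Qed.

Lemma qpiD : {morph qpi : x y / x + y}. Proof. exact: pi_addr. Qed.
Lemma qpi0 : qpi 0 = 0. Proof. exact: pi_zeror. Qed.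

Definition qmul (x y : algquot) : algquot := qpi (repr x * repr y).
Definition qscale (a : k) (x : algquot) : algquot := qpi (a *: repr x).

Lemma qpiM x y : qpi (x * y) = qmul (qpi x) (qpi y).
Proof.
apply/qpi_eq; set x' := repr _; set y' := repr _.
have -> : x * y - x' * y' = (x - x') * y + x' * (y - y').
  by rewrite mulrBl mulrBr addrA subrK.
by apply: ideal_genD; [apply: ideal_genMr|apply: ideal_genMl];
  apply/qpi_eq; rewrite qpiK.
Qed.

Lemma qpiZ a x : qpi (a *: x) = qscale a (qpi x).
Proof.
apply/qpi_eq; rewrite -scalerBr -mulr_algl; apply: ideal_genMl.
by apply/qpi_eq; rewrite qpiK.
Qed.

Lemma qmulA : associative qmul.
Proof.
by move=> x y z; rewrite -(qpiK x) -(qpiK y) -(qpiK z) -!qpiM mulrA.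
Qed.

Lemma qmul1 : left_id (qpi 1) qmul.
Proof. by move=> x; rewrite -(qpiK x) -!qpiM mul1r. Qed.

Lemma qmulr1 : right_id (qpi 1) qmul.
Proof. by move=> x; rewrite -(qpiK x) -!qpiM mulr1. Qed.

Lemma qmulDl : left_distributive qmul +%R.
Proof.
move=> x y z; rewrite -(qpiK x) -(qpiK y) -(qpiK z).
by rewrite -qpiD -!qpiM mulrDl qpiD.
Qed.

Lemma qmulDr : right_distributive qmul +%R.
Proof.
move=> x y z; rewrite -(qpiK x) -(qpiK y) -(qpiK z).
by rewrite -qpiD -!qpiM mulrDr qpiD.
Qed.

HB.instance Definition _ := GRing.Zmodule_isPzRing.Build algquot
  qmulA qmul1 qmulr1 qmulDl qmulDr.

Lemma qscaleA a b x : qscale a (qscale b x) = qscale (a * b) x.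
Proof. by rewrite -(qpiK x) -!qpiZ scalerA. Qed.

Lemma qscale1 : left_id 1 qscale.
Proof. by move=> x; rewrite -(qpiK x) -!qpiZ scale1r. Qed.

Lemma qscaleDr : right_distributive qscale +%R.
Proof.
move=> a x y; rewrite -(qpiK x) -(qpiK y).
by rewrite -qpiD -!qpiZ scalerDr qpiD.
Qed.

Lemma qscaleDl x : {morph qscale^~ x : a b / a + b}.
Proof. by move=> a b; rewrite -(qpiK x) -!qpiZ scalerDl qpiD. Qed.

HB.instance Definition _ := GRing.Zmodule_isLmodule.Build k algquot
  qscaleA qscale1 qscaleDr qscaleDl.

Lemma qscaleAl (a : k) (x y : algquot) : a *: (x * y) = a *: x * y.
Proof.
rewrite -(qpiK x) -(qpiK y).
by rewrite -[qpi _ * _]qpiM -![a *: _]qpiZ -[qpi _ * _]qpiM scalerAl.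
Qed.

Section Lift.
Variables (B : nzRingType) (f : {rmorphism A -> B}).
Hypothesis f0 : forall x, S x -> f x = 0.

Lemma ideal_gen_ker x : ideal_gen x -> f x = 0.
Proof.
elim=> [y /f0 //||y z _ fy _ fz|a y _ fy|y a _ fy].
- exact: rmorph0.
- by rewrite rmorphD fy fz addr0.
- by rewrite rmorphM fy mulr0.
- by rewrite rmorphM fy mul0r.
Qed.

Lemma algquot_nontrivial : (1 : algquot) != 0.
Proof.
apply/eqP; rewrite -qpi0 => /qpi_eq; rewrite subr0 => /ideal_gen_ker/eqP.
by rewrite rmorph1 oner_eq0.
Qed.

Definition qlift (x : algquot) : B := f (repr x).

Lemma qlift_pi x : qlift (qpi x) = f x.
Proof.
by apply/eqP; rewrite -subr_eq0 -rmorphB; apply/eqP/ideal_gen_ker/qpi_eq/qpiK.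
Qed.

Lemma qlift_zmod_morphism : zmod_morphism qlift.
Proof.
move=> x y; rewrite -(qpiK x) -(qpiK y) !qlift_pi -rmorphB -qlift_pi.
congr qlift; apply/eqP; rewrite subr_eq -qpiD; apply/eqP.
by rewrite subrK.
Qed.

Lemma qlift_monoid_morphism : monoid_morphism qlift.
Proof.
split=> [|x y]; first by rewrite -[1]/(qpi 1) qlift_pi rmorph1.
by rewrite -(qpiK x) -(qpiK y) -[_ * _]qpiM !qlift_pi rmorphM.
Qed.

End Lift.

End AlgebraQuotient.

(* The free algebra on a set, with its generators.  It is locked because
   conversion may not terminate in practice if it unfolds {malg _}. *)
Fact free_key : unit. Proof. by []. Qed.

Definition free_pack (k : fieldType) (X : choiceType)
    : {A : lalgType k & X -> A} :=
  locked_with free_key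
    (existT (fun A : lalgType k => X -> A) ({malg k[{fmonom X}]} : lalgType k)
       (fun x => mkmalgU (fmu x) 1)).

Definition freealg (k : fieldType) (X : choiceType) : lalgType k :=
  projT1 (free_pack k X).

Definition freegen (k : fieldType) (X : choiceType) : X -> freealg k X :=
  projT2 (free_pack k X).

Lemma free_aug (k : fieldType) (X : choiceType) :
  exists f : {rmorphism freealg k X -> k},
    (forall x, f (freegen k x) = 0) /\ (forall a u, f (a *: u) = a * f u).
Proof.
rewrite /freegen /freealg /free_pack unlock /=.
exists (@mcoeff {fmonom X} k (@mone {fmonom X})); split=> [x|a u].
  apply: etrans (mcoeffU _ _ _) _.
  by rewrite -val_eqE /= fm1 fmU.
exact: mcoeffZ.
Qed.

Lemma freealg_ind (k : fieldType) (X : choiceType) (P : freealg k X -> Prop) :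
  P 0 -> P 1 -> (forall a u v, P u -> P v -> P (a *: u + v)) ->
  (forall x u, P u -> P (freegen k x * u)) -> forall u, P u.
Proof.
move: P; rewrite /freegen /freealg /free_pack unlock /= => P P0 P1 PD PX u.
rewrite (monalgE u); elim/big_ind: _ => //.
  by move=> x y Px Py; rewrite -[x]scale1r; apply: PD.
move=> m _; have -> : mkmalgU m (mcoeff m u)
    = mcoeff m u *: mkmalgU m (1 : k) + 0 :> {malg k[{fmonom X}]}.
  rewrite addr0; apply/malgP=> n; rewrite mcoeffZ !mcoeffU.
  by case: (m == n); rewrite ?mulr1n ?mulr0n ?mulr1 ?mulr0.
apply: PD => //; case: m => s; elim: s => [|x s IHs].
  by have <- : (1 : {malg k[{fmonom X}]}) = mkmalgU (FMonom [::]) 1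
    by rewrite -fmoneE.
have -> : mkmalgU (FMonom (x :: s)) (1 : k)
    = (mkmalgU (fmu x) 1 : {malg k[{fmonom X}]}) * mkmalgU (FMonom s) 1.
  by rewrite malgM_def fgmulUU mulr1; congr mkmalgU; apply/val_inj;
    rewrite /= fmM fmU.
exact: PX.
Qed.

Section Enveloping.
Variables (k : fieldType) (p : nat) (charkp : p \in [pchar k]).
Variable g : restrictedLieAlgebra charkp.

Local Notation "'X_ x" := (freegen k (x : g)) (at level 8, x at level 2).

(* The linearity relations turn the free algebra on the set g into the tensor
   algebra T(g). *)
Inductive uenv_rel : set (freealg k g) :=
| uenv_linear a x y : uenv_rel ('X_(a *: x + y) - (a *: 'X_x + 'X_y))
| uenv_bracket x y : uenv_rel ('X_x * 'X_y - 'X_y * 'X_x - 'X_(bracket x y)).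

(* The universal enveloping algebra U(g) = T(g)/(xy - yx - [x, y]). *)
Definition uenv := algquot uenv_rel.
HB.instance Definition _ := GRing.PzRing.on uenv.
HB.instance Definition _ := GRing.Lmodule.on uenv.

Lemma free_aug_rel : exists f : {rmorphism freealg k g -> k},
  (forall x, f 'X_x = 0) /\ (forall u, uenv_rel u -> f u = 0).
Proof.
have [f [fX fZ]] := free_aug k g; exists f; split=> // u [a x y|x y].
  by rewrite rmorphB rmorphD /= fZ !fX mulr0 addr0 subr0.
by rewrite !rmorphB !rmorphM /= !fX mulr0 !subr0.
Qed.

Fact uenv_nontrivial : (1 : uenv) != 0.
Proof. by have [f [_ fR]] := free_aug_rel; apply: algquot_nontrivial fR. Qed.

HB.instance Definition _ := GRing.PzSemiRing_isNonZero.Build uenv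
  uenv_nontrivial.
HB.instance Definition _ := GRing.LSemiModule_isLSemiAlgebra.Build k uenv
  (@qscaleAl _ _ uenv_rel).

Definition uenv_gen (x : g) : uenv := qpi uenv_rel 'X_x.

Inductive renv_rel : set uenv :=
| renv_ppow x : renv_rel (uenv_gen x ^+ p - uenv_gen (ppow x)).

(* The restricted enveloping algebra U_0(g) = U(g)/(x^p - x^[p]). *)
Definition renv := algquot renv_rel.
HB.instance Definition _ := GRing.PzRing.on renv.
HB.instance Definition _ := GRing.Lmodule.on renv.

Fact renv_nontrivial : (1 : renv) != 0.
Proof.
have [f [fX fR]] := free_aug_rel.
pose fA := GRing.isZmodMorphism.Build uenv k (qlift f) (qlift_zmod_morphism fR).
pose fM := GRing.isMonoidMorphism.Build uenv k (qlift f)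
  (qlift_monoid_morphism fR).
pose h : {rmorphism uenv -> k} := HB.pack (qlift f : uenv -> k) fA fM.
apply: (@algquot_nontrivial _ _ renv_rel k h) => _ [x].
have h0 y : h (uenv_gen y) = 0 by rewrite -[RHS](fX y); apply: qlift_pi fR _.
rewrite rmorphB rmorphXn !h0 subr0 expr0n.
by rewrite gtn_eqF // prime_gt0 // (pcharf_prime charkp).
Qed.

HB.instance Definition _ := GRing.PzSemiRing_isNonZero.Build renv
  renv_nontrivial.
HB.instance Definition _ := GRing.LSemiModule_isLSemiAlgebra.Build k renv
  (@qscaleAl _ _ renv_rel).

Definition renv_gen (x : g) : renv := qpi renv_rel (uenv_gen x).

Lemma uenv_gen_linear : linear uenv_gen.
Proof.
move=> a x y; rewrite /uenv_gen -[a *: qpi _ _]qpiZ -qpiD.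
by apply/qpi_eq/ideal_gen_mem; constructor.
Qed.

Lemma uenv_gen_bracket x y :
  uenv_gen (bracket x y) = uenv_gen x * uenv_gen y - uenv_gen y * uenv_gen x.
Proof.
have M z t : uenv_gen z * uenv_gen t = qpi uenv_rel ('X_z * 'X_t).
  by rewrite qpiM.
apply/eqP; rewrite eq_sym subr_eq !M -qpiD; apply/eqP/qpi_eq.
by rewrite opprD addrA addrAC; apply/ideal_gen_mem; constructor.
Qed.

Lemma renv_gen_linear : linear renv_gen.
Proof.
by move=> a x y; rewrite /renv_gen uenv_gen_linear qpiD qpiZ.
Qed.

Lemma renv_gen_bracket x y :
  renv_gen (bracket x y) = renv_gen x * renv_gen y - renv_gen y * renv_gen x.
Proof.
have M z t : renv_gen z * renv_gen t = qpi renv_rel (uenv_gen z * uenv_gen t).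
  by rewrite qpiM.
apply/eqP; rewrite eq_sym subr_eq !M -qpiD.
by rewrite uenv_gen_bracket subrK.
Qed.

Lemma renv_gen_ppow x : renv_gen (ppow x) = renv_gen x ^+ p.
Proof.
have E n : renv_gen x ^+ n = qpi renv_rel (uenv_gen x ^+ n).
  by elim: n => [//|n IHn]; rewrite !exprS IHn qpiM.
by rewrite E; apply/esym/qpi_eq/ideal_gen_mem; constructor.
Qed.

Lemma renv_ind (P : renv -> Prop) :
  P 0 -> P 1 -> (forall a u v, P u -> P v -> P (a *: u + v)) ->
  (forall x u, P u -> P (renv_gen x * u)) -> forall u, P u.
Proof.
move=> P0 P1 PD PX u; rewrite -(qpiK u); move: (repr u) => {}u.
rewrite -(qpiK u); move: (repr u) => {}u.
elim/freealg_ind: u => [||a u v Pu Pv|x u Pu].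
- by rewrite !qpi0.
- exact: P1.
- by rewrite !qpiD !qpiZ; apply: PD.
- by rewrite !qpiM; apply: PX.
Qed.

End Enveloping.

(* Finite-dimensional left modules over a k-algebra A; the endomorphism algebra
   is not a ring type when the zero module is allowed, so multiplicativity is
   stated separately. *)
Record fdModule (k : fieldType) (A : lalgType k) := FdModule {
  fdm_sort :> vectType k;
  fdm_act : {linear A -> 'End(fdm_sort)};
  fdm_act1 : fdm_act 1 = \1%VF;
  fdm_actM : forall a b, fdm_act (a * b) = (fdm_act a \o fdm_act b)%VF
}.

(* The subspace with underlying set P, when P is closed under linear
   combinations. *)
Definition vspace_of (k : fieldType) (V : vectType k) (P : V -> Prop)
    : {vspace V} :=
  xget 0%VS [set W : {vspace V} | forall v, v \in W <-> P v]%classic.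

Lemma memv_vspace_of (k : fieldType) (V : vectType k) (P : V -> Prop) :
  P 0 -> (forall a u v, P u -> P v -> P (a *: u + v)) ->
  forall v, v \in vspace_of P <-> P v.
Proof.
move=> P0 PL; apply: (@xgetPex {vspace V} 0%VS
  [set W : {vspace V} | forall v, v \in W <-> P v]%classic).
pose Q n := `[< exists2 W : {vspace V}, \dim W = n & forall v, v \in W -> P v >].
have exQ : exists n, Q n.
  exists 0%N; apply/asboolP; exists 0%VS; first exact: dimv0.
  by move=> v; rewrite memv0 => /eqP->.
have ubQ n : Q n -> (n <= \dim {:V})%N.
  by move=> /asboolP[W <- _]; apply: dimvS (subvf W).
case: (ex_maxnP exQ ubQ) => n /asboolP[W dW WP] maxn.
exists W => v; split=> [|Pv]; first exact: WP.
have QW : Q (\dim (<[v]> + W)%VS).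
  apply/asboolP; exists (<[v]> + W)%VS => // u /memv_addP[x /vlineP[a ->] [w Ww ->]].
  by apply: PL => //; apply: WP.
have := maxn _ QW; rewrite -dW => le.
have /eqP -> : W == (<[v]> + W)%VS by rewrite eqEdim addvSr.
exact: (subvP (addvSl _ _)) (memv_line v).
Qed.

Section Submodules.
Variables (k : fieldType) (A : lalgType k) (M : fdModule A).
Implicit Types N : {vspace M}.

Definition submodule N := forall a, (fdm_act M a @: N <= N)%VS.

Definition maximal_submodule N :=
  [/\ submodule N, N <> fullv
    & forall N', submodule N' -> (N <= N')%VS -> N' = N \/ N' = fullv].

Definition simple_submodule N :=
  [/\ submodule N, N <> 0%VS
    & forall N', submodule N' -> (N' <= N)%VS -> N' = 0%VS \/ N' = N].

Definition Rad : {vspace M} :=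
  vspace_of (fun v : M => forall N, maximal_submodule N -> v \in N).

Definition Soc : {vspace M} :=
  vspace_of (fun v : M => exists2 s : seq {vspace M},
    forall N, N \in s -> simple_submodule N & v \in (\sum_(N <- s) N)%VS).

Lemma memv_Rad (v : M) :
  v \in Rad <-> forall N, maximal_submodule N -> v \in N.
Proof.
move: v; apply: memv_vspace_of => [N _|a u v Pu Pv N maxN]; first exact: mem0v.
by rewrite memvD ?memvZ ?Pu ?Pv.
Qed.

Lemma memv_Soc (v : M) :
  v \in Soc <-> exists2 s : seq {vspace M},
    forall N, N \in s -> simple_submodule N & v \in (\sum_(N <- s) N)%VS.
Proof.
move: v; apply: memv_vspace_of => [|a u v [s Ps us] [t Pt vt]].
  by exists [::] => //; rewrite mem0v.
exists (s ++ t) => [N|]; first by rewrite mem_cat => /orP[/Ps|/Pt].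
by rewrite big_cat memv_add ?memvZ.
Qed.

End Submodules.

(* dim V/W *)
Definition codimv (k : fieldType) (V : vectType k) (W : {vspace V}) : nat :=
  (\dim {:V} - \dim W)%N.

Fixpoint lfun_exp (k : fieldType) (V : vectType k) (f : 'End(V)) (j : nat)
    : 'End(V) :=
  if j is i.+1 then (f \o lfun_exp f i)%VF else \1%VF.

Section ModuleProperties.
Variables (k : fieldType) (p : nat) (charkp : p \in [pchar k]).
Variables (g : restrictedLieAlgebra charkp) (M : fdModule (renv g)).

(* The operator x_M. *)
Definition opM (x : g) : 'End(M) := fdm_act M (renv_gen x).

Definition constant_rank :=
  forall x y : g, x <> 0 -> y <> 0 -> \dim (limg (opM x)) = \dim (limg (opM y)).

Definition equal_images := forall (x y : g) (j : nat),
  x <> 0 -> y <> 0 -> (1 <= j <= p - 1)%N ->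
  limg (lfun_exp (opM x) j) = limg (lfun_exp (opM y) j).

Definition equal_kernels := forall (x y : g) (j : nat),
  x <> 0 -> y <> 0 -> (1 <= j <= p - 1)%N ->
  lker (lfun_exp (opM x) j) = lker (lfun_exp (opM y) j).

Definition trivial_module := forall (x : g) (m : M), opM x m = 0.

End ModuleProperties.

(* Main.v *)
Require Import Defs.
From mathcomp Require Import all_boot all_order all_algebra.
From HB Require Import structures.
From mathcomp Require Import boolp.

(* Engel's theorem shows that g annihilates every simple U_0(g)-module, so the
   operators x_M have image in Rad(M) and vanish on Soc(M).  The heart of the
   proof is linear algebra: an n-dimensional space T of linear maps V -> R of
   constant rank d, with dim R < n, consists of maps with the same image.

   Every v is killed by some x <> 0 in T because dim R < n.  The rank of x + t y
   never exceeds that of x, hence y (ker x) is contained in im x and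
   T v <= im x.  For v with dim T v maximal, the same argument applied to the
   maps T -> R, x |-> x u, gives im x <= T v.  So every nonzero x in
   T_v = {x | x v = 0} has image W = T v.  If W <> R then dim T_v >= 2; let phi
   be a functional vanishing on W.  The second-order consequence of rank
   maximality shows that phi o y vanishes on ker x for all y in T and all x <> 0
   in T_v.  The kernels of a pencil of maps that all map onto W span V, hence
   phi o y = 0 and im y = W.

   Applied to the transposes, this gives equal kernels.  Powers follow from a
   nonzero central z in g: x^(j+1) M = x z^j M = z^j x M = z^(j+1) M. *)

Set Implicit Arguments.
Unset Strict Implicit.
Unset Printing Implicit Defensive.

Import GRing.Theory.
Local Open Scope ring_scope.

(** * Matrix pencils and spaces of matrices of constant rank *)

Section Pencils.
Variable k : closedFieldType.

(** [P] is the polynomial t |-> x adj(1 + t N) b. It vanishes wherever t det(1 + t N) is nonzero,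
    hence identically over the infinite field k, and P(0) = x b. *)
Lemma resolvent_eval0 n (x : 'rV[k]_n) (N : 'M_n) (b : 'cV_n) :
  (forall t : k, t != 0 -> 1%:M + t *: N \in unitmx ->
     x *m invmx (1%:M + t *: N) *m b = 0) ->
  x *m b = 0.
Proof.
move=> H.
pose Np : 'M[{poly k}]_n := 1%:M + 'X *: map_mx polyC N.
pose P := (map_mx polyC x *m \adj Np *m map_mx polyC b) 0 0.
have evN t : map_mx (horner_eval t) Np = 1%:M + t *: N.
  rewrite /Np map_mxD map_mx1 map_mxZ -map_mx_comp.
  congr (_ + _ *: _); first by rewrite /= horner_evalE hornerX.
  by apply/matrixP=> i j; rewrite !mxE /= horner_evalE hornerC.
have evD t : (\det Np).[t] = \det (1%:M + t *: N).
  by rewrite -evN det_map_mx.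
have evC m1 m2 (A : 'M[k]_(m1, m2)) (t : k) :
    map_mx (horner_eval t) (map_mx polyC A) = A.
  by apply/matrixP=> i j; rewrite !mxE /= horner_evalE hornerC.
have evP t : P.[t] = (x *m \adj (1%:M + t *: N) *m b) 0 0.
  by rewrite -horner_evalE -evN -map_mx_adj -[x in RHS](evC _ _ _ t)
     -[b in RHS](evC _ _ _ t) -!map_mxM [RHS]mxE.
have D0 : \det Np != 0.
  apply/eqP=> D0; have := evD 0; rewrite D0 scale0r addr0 det1 horner0.
  by move/eqP; rewrite eq_sym oner_eq0.
have P0 : P = 0.
  apply/eqP; apply: contraT => nzP.
  have : 'X * \det Np * P != 0 by rewrite !mulf_neq0 ?polyX_eq0.
  case/closed_nonrootP=> t; rewrite rootE !hornerM hornerX !mulf_eq0 !negb_or.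
  rewrite -andbA; case/and3P=> t0 Dt Pt.
  have Ut : 1%:M + t *: N \in unitmx by rewrite unitmxE -evD unitfE.
  have := H t t0 Ut; rewrite /invmx Ut -scalemxAr -scalemxAl => /eqP.
  rewrite scaler_eq0 invr_eq0 -evD (negPf Dt) /= => /eqP Z.
  by rewrite evP Z mxE eqxx in Pt.
have := evP 0; rewrite P0 horner0 scale0r addr0 adj1 mulmx1 => Z.
by apply/matrixP=> i j; rewrite !ord1 -Z mxE.
Qed.

(** Up to sign, the x N^i b are the Taylor coefficients of the resolvent at t = 0. As x b = 0,
    dividing x (1 + t N)^-1 (b + t N b) = x b by t passes the hypothesis from b to N b. *)
Lemma resolvent_series0 n (x : 'rV[k]_n) (N : 'M_n) (b : 'cV_n) :
  (forall t : k, t != 0 -> 1%:M + t *: N \in unitmx ->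
     x *m invmx (1%:M + t *: N) *m b = 0) ->
  forall i, x *m iter i (mulmx N) b = 0.
Proof.
move=> H i; elim: i b H => [|i IHi] b H; first exact: resolvent_eval0 H.
rewrite iterSr; apply: IHi => t t0 Ut.
have := H t t0 Ut; have xb := resolvent_eval0 H.
have : x *m invmx (1%:M + t *: N) *m ((1%:M + t *: N) *m b) = 0.
  by rewrite -mulmxA mulKmx.
rewrite mulmxDl mul1mx mulmxDr => + e; rewrite e add0r -scalemxAl -scalemxAr.
by move/eqP; rewrite scaler_eq0 (negPf t0) => /eqP.
Qed.

Section MaximalRank.
Variables (n r : nat) (E w : 'M[k]_(n, r)).
Hypothesis maxE : forall t, (\rank (E + t *: w)%R <= \rank E)%N.

(* With N = w G and G a partial inverse of E, the vector x (1 + t N)^-1 is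
   killed by E + t w when x is killed by E; this is its expansion at t = 0. *)
Lemma maximal_rank_series x (phi : 'cV_r) i : x *m E = 0 -> E *m phi = 0 ->
  x *m iter i (mulmx (w *m pinvmx E)) (w *m phi) = 0 :> 'M_1.
Proof.
move=> xE Ephi; apply: resolvent_series0 => t t0 Ut.
set N := w *m _ in Ut *; pose x' := x *m invmx (1%:M + t *: N).
pose z := x' *m (E + t *: w).
have EGE : E *m pinvmx E *m E = E by apply: mulmxKpV.
have e : (E + t *: w) *m (pinvmx E *m E) = (1%:M + t *: N) *m E.
  by rewrite mulmxA !mulmxDl EGE mul1mx -!scalemxAl.
have zK : z *m (pinvmx E *m E) = 0.
  by rewrite /z -mulmxA e /x' mulmxA mulmxKV.
(* Right multiplication by [pinvmx E *m E] leaves a matrix of rank equal to that of E; by [maxE] it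
   is therefore injective on the row space of E + t w. *)
have z0 : z = 0.
  have re : \rank ((E + t *: w)%R *m (pinvmx E *m E)) = \rank E.
    by rewrite e eqmxMfull // row_full_unit.
  have := mxrank_mul_ker (E + t *: w) (pinvmx E *m E).
  move=> h; have := maxE t; rewrite -h re -{2}[\rank E]addn0 leq_add2l leqn0.
  rewrite mxrank_eq0 => /eqP c0; apply/eqP; rewrite -submx0 -c0 sub_capmx.
  by rewrite submxMl /=; apply/sub_kermxP.
have : z *m phi = 0 by rewrite z0 mul0mx.
rewrite /z mulmxDr mulmxDl -mulmxA Ephi mulmx0 add0r -scalemxAr -scalemxAl.
by move/eqP; rewrite scaler_eq0 (negPf t0) /= -(mulmxA x') => /eqP.
Qed.

(** This is the order-zero term of the series, read on the columns of [cokermx E]: they are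
    functionals cutting out the row space of E. *)
Lemma maximal_rank_kernel m (x : 'M_(m, n)) : x *m E = 0 -> (x *m w <= E)%MS.
Proof.
move=> xE; rewrite submxE; apply/eqP/matrixP=> i j.
have := maximal_rank_series (x := row i x) (phi := col j (cokermx E)) 0.
rewrite -row_mul xE row0 colE mulmxA mulmx_coker mul0mx.
move=> /(_ erefl erefl) /= /matrixP/(_ 0 0); rewrite !mulmxA -colE -!row_mul.
by rewrite !mxE.
Qed.

End MaximalRank.

(** [P] stands for an N-stable space. Applying the linear factors of the characteristic polynomial
    to psi one by one ends at 0 by Cayley-Hamilton; the last nonzero vector is an eigenvector. *)
Lemma eigenvector_in_orbit m (N : 'M[k]_m) (psi : 'cV_m) (P : 'cV_m -> Prop) :
  (forall a u v, P u -> P v -> P (a *: u + v)) ->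
  (forall u, P u -> P (N *m u)) -> P psi -> psi != 0 ->
  exists2 eta, P eta /\ eta != 0 & exists t, N *m eta = t *: eta.
Proof.
case: m => [|m] in N psi P *; first by rewrite (flatmx0 psi) eqxx.
move=> PL PN.
have [s] := closed_field_poly_normal (char_poly N).
rewrite (monicP (char_poly_monic N)) scale1r => cN.
have : horner_mx N (\prod_(z <- s) ('X - z%:P)) *m psi = 0.
  by rewrite -cN Cayley_Hamilton mul0mx.
elim: s psi {cN} => [|t s IHs] psi.
  by rewrite big_nil rmorph1 mul1mx => ->; rewrite eqxx.
rewrite big_cons mulrC rmorphM /= -mulmxE -mulmxA => H Ppsi nz.
have e : horner_mx N ('X - t%:P) *m psi = - t *: psi + N *m psi.
  rewrite rmorphB /= horner_mx_X horner_mx_C mulmxBl mul_scalar_mx scaleNr.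
  by rewrite addrC.
have [z|z] := eqVneq (horner_mx N ('X - t%:P) *m psi) 0; last first.
  by apply: (IHs _ H) z; rewrite e; apply: PL => //; apply: PN.
exists psi => //; exists t; move: z; rewrite e scaleNr addrC => /eqP.
by rewrite subr_eq0 => /eqP.
Qed.

(** Let G be a partial inverse of X and N = Y G. If psi is nonzero, some eigenvector eta of N, with
    eigenvalue t, vanishes on ker X. Then Y - t X kills the column G eta, hence so does X, although
    X G eta = eta. *)
Lemma surjective_pencil_kernels m r (X Y : 'M[k]_(m, r)) (psi : 'cV_m) :
  (forall a b, (a, b) != 0 -> ((a *: X + b *: Y)%R :=: X)%MS) ->
  (forall a b, (a, b) != 0 -> forall u : 'rV_m,
     u *m (a *: X + b *: Y) = 0 -> u *m psi = 0) ->
  psi = 0.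
Proof.
move=> imP kerP; apply/eqP; apply: contraT => nz.
have nz1 (b : k) : (1 : k, b) != 0 by rewrite xpair_eqE oner_eq0.
pose G := pinvmx X; pose N := Y *m G.
have XGX : X *m G *m X = X by apply: mulmxKpV.
have YGX : N *m X = Y.
  apply: mulmxKpV; have := imP 0 1; rewrite scale0r scale1r add0r => -> //.
  by rewrite xpair_eqE oner_eq0 andbF.
(* Since (1 + t N) X = X + t Y, the row u (1 + t N)^-1 lies in the kernel of X + t Y. *)
have kX (u : 'rV_m) i : u *m X = 0 -> u *m iter i (mulmx N) psi = 0.
  move=> uX; apply: resolvent_series0 => t t0 Ut.
  apply: (kerP 1 t) => //; rewrite scale1r mulmxDr -scalemxAr.
  set u' := u *m _; have : u' *m (1%:M + t *: N) *m X = 0.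
    by rewrite /u' mulmxKV.
  by rewrite mulmxDr mulmx1 -scalemxAr mulmxDl -scalemxAl -(mulmxA u') YGX.
(* The rows of 1 - X G span ker X, so [P v] says that every N^i v vanishes on ker X. *)
pose P (v : 'cV_m) :=
  forall i, X *m G *m iter i (mulmx N) v = iter i (mulmx N) v.
have iterL i a u v :
    iter i (mulmx N) (a *: u + v)
    = a *: iter i (mulmx N) u + iter i (mulmx N) v.
  by elim: i => //= i ->; rewrite mulmxDr -scalemxAr.
have [||| |eta [Peta nzeta] [t Neta]] := @eigenvector_in_orbit _ N psi P.
- by move=> a u v Pu Pv i; rewrite iterL mulmxDr -scalemxAr Pu Pv.
- by move=> u Pu i; rewrite -iterSr Pu.
- move=> i; apply/eqP; rewrite eq_sym -subr_eq0 -{1}[iter i _ _]mul1mx -mulmxBl.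
  apply/eqP/row_matrixP=> j; rewrite row_mul row0; apply: kX.
  by rewrite -row_mul mulmxBl mul1mx XGX subrr row0.
- by [].
have XGeta := Peta 0%N; rewrite /= in XGeta.
suff: X *m (G *m eta) = 0 by rewrite mulmxA XGeta => e; rewrite e eqxx in nzeta.
have nzt : (- t, 1 : k) != 0 by rewrite xpair_eqE oner_eq0 andbF.
have /submxP[D ->] : (X <= ((- t) *: X + 1 *: Y)%R)%MS by rewrite imP.
rewrite -mulmxA mulmxDl -!scalemxAl scale1r mulmxA XGeta mulmxA -/N Neta.
by rewrite scaleNr addNr mulmx0.
Qed.


(** Vectors are rows, so the row space of [X x] is the image of x; [S] plays the role of R. *)
Lemma constant_rank_images n m r q (X : {linear 'rV[k]_n -> 'M[k]_(m, r)})
    (S : 'M_(q, r)) :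
  (forall x, (X x <= S)%MS) -> (\rank S < n)%N ->
  (forall x y, x != 0 -> y != 0 -> \rank (X x) = \rank (X y)) ->
  forall x y, x != 0 -> y != 0 -> (X x :=: X y)%MS.
Proof.
move=> XS ltSn cr.
(* [E v] is the matrix of the map x |-> x v on T; its row space is T v. *)
pose E v := lin1_mx (mulmx v \o X).
have EP x v : x *m E v = v *m X x by rewrite mul_rV_lin1.
have EL a u v : E (a *: u + v) = a *: E u + E v.
  apply/row_matrixP=> i; rewrite [RHS]linearP /= !rowE !EP.
  by rewrite mulmxDl -scalemxAl.
have ES v : (E v <= S)%MS.
  apply/row_subP=> i; rewrite rowE EP.
  by apply: submx_trans (submxMl _ _) (XS _).
have ltEn v : (\rank (E v) < n)%N by apply: leq_ltn_trans ltSn; apply: mxrankS.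
have EsubX x v : x != 0 -> x *m E v = 0 -> (E v <= X x)%MS.
  rewrite EP => x0 vx; apply/row_subP=> i; rewrite rowE EP.
  apply: maximal_rank_kernel vx => t; rewrite addrC -linearP.
  have [->|nz] := eqVneq (t *: delta_mx 0 i + x) 0; last by rewrite (cr _ x).
  by rewrite linear0 mxrank0.
have [v maxv] : exists v, forall v', (\rank (E v') <= \rank (E v))%N.
  pose Q d := `[< exists v, \rank (E v) = d >].
  have exQ : exists d, Q d by exists (\rank (E 0)); apply/asboolP; exists 0.
  have ubQ d : Q d -> (d <= n)%N by move=> /asboolP[v <-]; apply: rank_leq_row.
  case: (ex_maxnP exQ ubQ) => d /asboolP[v <-] maxd.
  by exists v => v'; apply: maxd; apply/asboolP; exists v'.
have maxE u t : (\rank (E v + t *: E u)%R <= \rank (E v))%N.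
  by rewrite addrC -EL.
(* Rank maximality at v gives the reverse inclusion, with T and V exchanged. *)
have XsubE x : x *m E v = 0 -> (X x <= E v)%MS.
  move=> xv; apply/row_subP=> j; rewrite rowE -EP.
  exact: (maximal_rank_kernel (maxE _)).
have eqW x : x != 0 -> x *m E v = 0 -> (X x :=: E v)%MS.
  by move=> x0 xv; apply/eqmxP; rewrite XsubE // EsubX.
have kerW x : ((x <= kermx (E v)) = (x *m E v == 0 :> 'rV_r))%MS.
  by apply/sub_kermxP/eqP.
(* Inclusion suffices: [E v] has a nonzero kernel, whose nonzero elements have image exactly W, so
   the constant rank is that of [E v]. *)
suff W y : (X y <= E v)%MS.
  have [x0 /eqP] : exists2 x : 'rV_n, x *m E v == 0 & x != 0.
    have /rowV0Pn[x] : kermx (E v) != 0.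
      by rewrite -mxrank_eq0 mxrank_ker subn_eq0 -ltnNge.
    by rewrite kerW; exists x.
  move=> xv x0n.
  have eqy y : y != 0 -> (X y :=: E v)%MS.
    move=> y0; apply/eqmxP; rewrite -(geq_leqif (mxrank_leqif_eq (W y))).
    by rewrite (cr y x0) // eqW.
  by move=> x y x0' y0; apply: eqmx_trans (eqy x x0') (eqmx_sym (eqy y y0)).
have [SE|nSE] := boolP (S <= E v)%MS; first exact: submx_trans (XS y) SE.
have ltES : (\rank (E v) < \rank S)%N.
  rewrite ltn_neqAle mxrankS // andbT; apply: contra nSE.
  by rewrite (mxrank_leqif_eq (ES v)) => /andP[].
(* There are two strict inequalities between [\rank (E v)] and n, so the kernel contains a
   pencil. *)
have rK : (1 < \rank (kermx (E v)))%N.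
  by rewrite mxrank_ker ltn_subRL addn1; apply: leq_ltn_trans ltES ltSn.
have [x1 x1v x10] : exists2 x : 'rV_n, (x <= kermx (E v))%MS & x != 0.
  by apply/rowV0Pn; rewrite -mxrank_eq0 -lt0n ltnW.
have [x2 x2v x21] : exists2 x : 'rV_n, (x <= kermx (E v))%MS & ~~ (x <= x1)%MS.
  have /row_subPn[i xi] : ~~ (kermx (E v) <= x1)%MS.
    apply: contraL rK => /mxrankS le; rewrite -leqNgt.
    exact: leq_trans le (rank_leq_row _).
  by exists (row i (kermx (E v))); rewrite ?row_sub.
have pencil a b : (a, b) != 0 ->
    a *: x1 + b *: x2 != 0 /\ (a *: x1 + b *: x2) *m E v = 0.
  move=> ab; split; last first.
    move: x1v x2v; rewrite !kerW => /eqP x1v /eqP x2v.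
    by rewrite mulmxDl -!scalemxAl x1v x2v !scaler0 addr0.
  apply: contra x21 => /eqP; have [b0|b0] := eqVneq b 0.
    rewrite b0 in ab *; rewrite scale0r addr0 => /eqP.
    rewrite scaler_eq0 (negPf x10) orbF => /eqP a0.
    by rewrite a0 eqxx in ab.
  move/eqP; rewrite addrC addr_eq0 => /eqP e.
  rewrite -(scalerK b0 x2) e; apply/scalemx_sub.
  by rewrite eqmx_opp; apply: scalemx_sub.
rewrite submxE; apply/eqP/matrixP=> i j; pose phi := col j (cokermx (E v)).
suff /matrixP/(_ i 0) : X y *m phi = 0 by rewrite /phi colE mulmxA -colE !mxE.
have Ephi : E v *m phi = 0 by rewrite /phi colE mulmxA mulmx_coker mul0mx.
have pX a b : a *: X x1 + b *: X x2 = X (a *: x1 + b *: x2).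
  by rewrite linearP linearZ.
apply: (@surjective_pencil_kernels _ _ (X x1) (X x2)) => a b ab.
  have [nz kx] := pencil a b ab; rewrite pX; apply: eqmx_trans (eqW _ nz kx) _.
  by apply/eqmx_sym/eqW => //; apply/eqP; rewrite -kerW.
move=> u; rewrite pX; have [] := pencil a b ab.
move: (a *: x1 + b *: x2) => x nz kx; rewrite -EP => xu.
pose G := pinvmx (E v).
(* This is the order-one term of the series at [E v]. *)
have Qww w : x *m E w *m G *m E w *m phi = 0.
  have := maximal_rank_series (maxE w) 1 kx Ephi.
  by rewrite /= !mulmxA.
have GE : y *m E v *m G *m E v = y *m E v by rewrite mulmxKpV ?submxMl.
clearbody G.
(* Polarization: replacing w by w + u and using x [E u] = 0 isolates the mixed term. *)
have Qwu w : x *m E w *m G *m E u *m phi = 0.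
  have := Qww (1 *: w + u); rewrite EL scale1r (mulmxDr x) xu addr0.
  by rewrite !mulmxDr !mulmxDl Qww add0r.
have XG : X x *m (G *m (E u *m phi)) = 0.
  apply/row_matrixP=> l; rewrite row_mul row0 rowE -EP !mulmxA.
  exact: Qwu.
have EG : E v *m (G *m (E u *m phi)) = 0.
  by have /submxP[D ->] := EsubX _ _ nz kx; rewrite -mulmxA XG mulmx0.
(* The corrected y is killed by [E v], so the order-zero term applies to it; [EG] then removes the
   correction. *)
have := maximal_rank_series (x := y - y *m E v *m G) (maxE u) 0 _ Ephi.
rewrite mulmxBl GE subrr => /(_ erefl) /=.
rewrite mulmxBl -!mulmxA EG mulmx0 subr0 => <-.
by rewrite !mulmxA EP.
Qed.

End Pencils.

(** * Engel's theorem *)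

Section LinearFun.
Variables (R : pzRingType) (U V : lmodType R) (f : U -> V).
Hypothesis lf : linear f.

Lemma linear_fun0 : f 0 = 0.
Proof. by have := lf (-1) 0 0; rewrite scaler0 addr0 scaleN1r addNr. Qed.

Lemma linear_funD x y : f (x + y) = f x + f y.
Proof. by have := lf 1 x y; rewrite !scale1r. Qed.

Lemma linear_funZ a x : f (a *: x) = a *: f x.
Proof. by have := lf a x 0; rewrite linear_fun0 !addr0. Qed.

End LinearFun.

Section Engel.
Variables (k : fieldType) (p : nat) (charkp : p \in [pchar k]).
Variable g : restrictedLieAlgebra charkp.

(** [rho] is a bare map so that both [bracket] and [opM M] are instances. *)
Record nil_representation (V : vectType k) (rho : g -> V -> V) := NilRep {
  nil_rep_linearl : forall v, linear (rho^~ v);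
  nil_rep_linearr : forall x, linear (rho x);
  nil_rep_bracket : forall x y v,
    rho (bracket x y) v = rho x (rho y v) - rho y (rho x v);
  nil_rep_nilpotent : forall x v, exists i, iter i (rho x) v = 0
}.

Lemma bracketC (x y : g) : bracket x y = - bracket y x.
Proof.
have := bracketxx (x + y).
rewrite (linear_funD (bracket_linearl _)) !(linear_funD (bracket_linearr _)).
rewrite !bracketxx add0r addr0.
by move/eqP; rewrite addr_eq0 => /eqP.
Qed.

(** Nilpotency comes from (ad x)^p = ad(x^[p]) = 0, and compatibility with brackets is the Jacobi
    identity. *)
Lemma ad_nil_representation :
  p_trivial g -> nil_representation (@bracket _ _ _ g).
Proof.
move=> gp; split=> [x|x|x y z|x y].
- exact: bracket_linearl.
- exact: bracket_linearr.
- have := jacobi x y z; rewrite (bracketC z x) (bracketC z).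
  rewrite -[- bracket x z]scaleN1r (linear_funZ (bracket_linearr y)) scaleN1r.
  by move/eqP; rewrite subr_eq0 => /eqP.
- by exists p; rewrite -ppow_ad gp (linear_fun0 (bracket_linearl y)).
Qed.

Definition subalgebra (K : {vspace g}) :=
  forall x y, x \in K -> y \in K -> bracket x y \in K.

Lemma subalgebra_add_line (H : {vspace g}) x :
  subalgebra H -> (forall h, h \in H -> bracket h x \in H) ->
  subalgebra (H + <[x]>).
Proof.
move=> sH nx _ _ /memv_addP[h Hh [_ /vlineP[a ->] ->]]
                 /memv_addP[h' Hh' [_ /vlineP[b ->] ->]].
apply: (subvP (addvSl H <[x]>)).
rewrite (linear_funD (bracket_linearl _)) !(linear_funD (bracket_linearr _)).
rewrite !(linear_funZ (bracket_linearl _)) !(linear_funZ (bracket_linearr _)).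
rewrite bracketxx !scaler0 addr0 (bracketC x) !memvD ?memvZ ?memvN //.
  exact: sH.
all: exact: nx.
Qed.

(* The pair A <= B stands for the quotient B/A; the induction step uses the
   action of a subalgebra H on K/H. *)
Lemma engel (K : {vspace g}) (V : vectType k) (rho : g -> V -> V)
    (A B : {vspace V}) :
  p_trivial g -> subalgebra K -> nil_representation rho ->
  (A <= B)%VS -> ~~ (B <= A)%VS ->
  (forall x v, x \in K -> v \in A -> rho x v \in A) ->
  (forall x v, x \in K -> v \in B -> rho x v \in B) ->
  exists2 v, v \in B & v \notin A /\ forall x, x \in K -> rho x v \in A.
Proof.
move=> gp; have [d] := ubnP (\dim K).
elim: d => // d IHd in K V rho A B * => ltKd sK rep sAB nBA KA KB.
have [rl rr rb rn] := rep.
have [K0|nzK] := eqVneq K 0%VS.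
  have /subvPn[v vB vA] := nBA; exists v => //; split=> // x.
  by rewrite K0 memv0 => /eqP->; rewrite (linear_fun0 (rl v)) mem0v.
pose Q h := `[< exists2 H : {vspace g}, subalgebra H /\ (H <= K)%VS
                & \dim H = h /\ (h < \dim K)%N >].
have exQ : exists h, Q h.
  exists 0%N; apply/asboolP; exists 0%VS.
    split; last exact: sub0v.
    move=> x y; rewrite !memv0 => /eqP-> _.
    by rewrite (linear_fun0 (bracket_linearl _)).
  by rewrite dimv0 lt0n dimv_eq0.
have ubQ h : Q h -> (h <= \dim K)%N by move=> /asboolP[H _ [_ /ltnW]].
case: (ex_maxnP exQ ubQ) => _ /asboolP[H [sH HK] [<- ltHK]] maxH.
have ltHd : (\dim H < d)%N by apply: leq_trans ltHK _.
have HKs h : h \in H -> h \in K by apply: (subvP HK).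
(* H is a proper subalgebra of K of largest dimension. Its adjoint action on K/H yields x outside H
   normalising H, whence H + <x> = K. *)
have [||x xK [xH nx]] := IHd H _ (@bracket _ _ _ g) H K ltHd sH
  (ad_nil_representation gp) HK _ sH.
- by apply: contraL ltHK => /dimvS; rewrite -leqNgt.
- by move=> h y /HKs; apply: sK.
have [||v vB [vA nv]] := IHd H _ rho A B ltHd sH rep sAB nBA.
- by move=> h u /HKs; apply: KA.
- by move=> h u /HKs; apply: KB.
have eK : (H + <[x]>)%VS = K.
  apply/eqP; rewrite eqEdim subv_add HK -memvE xK /= leqNgt; apply/negP=> ltK.
  have : (\dim (H + <[x]>) <= \dim H)%N.
    apply: maxH; apply/asboolP; exists (H + <[x]>)%VS => //; split.
      exact: subalgebra_add_line.
    by rewrite subv_add HK -memvE.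
  rewrite leqNgt ltn_neqAle dimvS ?addvSl // andbT negbK => /eqP eH.
  move: xH; have /eqP -> : H == (H + <[x]>)%VS by rewrite eqEdim addvSl eH /=.
  by rewrite memvE addvSr.
(* H kills every iterate modulo A, because h x = x h + [h, x] with [h, x] in H. The iterate just
   before the first one in A is also killed by x modulo A. *)
pose u i := iter i (rho x) v.
have uP i : u i \in B /\ forall h, h \in H -> rho h (u i) \in A.
  elim: i => [//|i [uB uH]]; split=> [|h hH]; first exact: KB.
  have := rb h x (u i); move/eqP; rewrite eq_sym subr_eq => /eqP ->.
  by apply: memvD; [apply/uH/nx|apply: KA (uH _ _)].
have exu : exists i, u i \in A.
  by have [i e] := rn x v; exists i; rewrite /u e mem0v.
case: (ex_minnP exu) => [[|i] uA mini]; first by rewrite uA in vA.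
have [uB uH] := uP i; exists (u i) => //; split.
  by apply/negP=> /mini; rewrite ltnn.
move=> y; rewrite -eK => /memv_addP[h Hh [_ /vlineP[a ->] ->]].
rewrite (linear_funD (rl _)) (linear_funZ (rl _)).
by apply: memvD; [apply: uH|apply: memvZ; apply: uA].
Qed.

End Engel.

(** * Families of linear maps of constant rank, in coordinates *)

Section ConstantRankFamilies.
Import VectorInternalTheory.
Variables (k : closedFieldType) (T V R : vectType k).

Lemma f2mx_linear : linear (@f2mx k V R).
Proof.
move=> a f g; apply/row_matrixP=> i; rewrite [RHS]linearP /=.
have E (h : 'Hom(V, R)) : row i (f2mx h) = v2r (h (r2v (delta_mx 0 i))).
  by rewrite unlock /= !r2vK rowE.
by rewrite !E add_lfunE scale_lfunE linearP.
Qed.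

Lemma vs2mx_limg (f : 'Hom(V, R)) : (vs2mx (limg f) :=: f2mx f)%MS.
Proof.
rewrite unlock; apply: eqmx_trans (mx2vsK _) _.
by apply: eqmxMfull; rewrite -sub1mx mx2vsK.
Qed.


Variable op : T -> 'Hom(V, R).
Hypothesis op_linear : linear op.
Hypothesis op_rank : forall x y, x != 0 -> y != 0 ->
  \dim (limg (op x)) = \dim (limg (op y)).

Let X x : 'M_(dim V, dim R) := f2mx (op (r2v x)).

Let X_linear : linear X.
Proof. by move=> a x y; rewrite /X linearP op_linear f2mx_linear. Qed.

Let X_rank x y : x != 0 -> y != 0 -> \rank (X x) = \rank (X y).
Proof.
move=> x0 y0; have := op_rank (x := r2v x) (y := r2v y).
rewrite /dimv !vs2mx_limg; apply;
  by rewrite -(inj_eq (@v2r_inj _ _)) r2vK linear0.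
Qed.

Let v2r_neq0 (x : T) : x != 0 -> v2r x != 0.
Proof. by rewrite -(inj_eq (@v2r_inj _ _)) linear0. Qed.

Lemma constant_rank_equal_limg (S : {vspace R}) :
  (forall x, limg (op x) <= S)%VS -> (\dim S < \dim {:T})%N ->
  forall x y, x != 0 -> y != 0 -> limg (op x) = limg (op y).
Proof.
rewrite dimvf => opS ltS x y x0 y0; apply/eqP; rewrite eqEsubv /subsetv.
pose Xl := GRing.isLinear.Build _ _ _ _ X X_linear.
pose XL : {linear 'rV[k]_(dim T) -> 'M[k]_(dim V, dim R)} := HB.pack X Xl.
have sub z : (XL z <= vs2mx S)%MS.
  by have := opS (r2v z); rewrite /subsetv vs2mx_limg.
have := constant_rank_images sub ltS X_rank (v2r_neq0 x0) (v2r_neq0 y0).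
by rewrite /= /X !v2rK => e; rewrite !vs2mx_limg !e submx_refl.
Qed.

(** Equal images of the transposes mean equal kernels. These images lie in [kermx (vs2mx S)^T], the
    annihilator of S, whose dimension is the codimension of S. *)
Lemma constant_rank_equal_lker (S : {vspace V}) :
  (forall x, S <= lker (op x))%VS -> (codimv S < \dim {:T})%N ->
  forall x y, x != 0 -> y != 0 -> lker (op x) = lker (op y).
Proof.
rewrite /codimv !dimvf => opS ltS.
pose Y x := (X x)^T.
have Y_linear : linear Y by move=> a x y; rewrite /Y X_linear linearP.
pose Yl := GRing.isLinear.Build _ _ _ _ Y Y_linear.
pose YL : {linear 'rV[k]_(dim T) -> 'M[k]_(dim R, dim V)} := HB.pack Y Yl.
have sub z : (YL z <= kermx (vs2mx S)^T)%MS.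
  have := opS (r2v z); rewrite /subsetv mx2vsK => /sub_kermxP e.
  by apply/sub_kermxP; rewrite /= /Y -trmx_mul e trmx0.
have ltK : (\rank (kermx (vs2mx S)^T) < dim T)%N.
  by rewrite mxrank_ker mxrank_tr.
have Y_rank x y : x != 0 -> y != 0 -> \rank (YL x) = \rank (YL y).
  by move=> x0 y0; rewrite /= /Y !mxrank_tr; apply: X_rank.
have ksub x y : x != 0 -> y != 0 -> (lker (op x) <= lker (op y))%VS.
  move=> x0 y0.
  have := constant_rank_images sub ltK Y_rank (v2r_neq0 x0) (v2r_neq0 y0).
  rewrite /= /Y /X !v2rK => e; rewrite /subsetv !mx2vsK; apply/sub_kermxP.
  have /submxP[D /(congr1 trmx)] : ((f2mx (op y))^T <= (f2mx (op x))^T)%MS.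
    by rewrite e.
  by rewrite trmx_mul !trmxK => ->; rewrite mulmxA mulmx_ker mul0mx.
by move=> x y x0 y0; apply/eqP; rewrite eqEsubv !ksub.
Qed.

(** Two independent elements x, y span a pencil with common image and common kernel. Each column of
    the matrix of [op x] vanishes on that kernel, so [surjective_pencil_kernels] makes it zero. *)
Lemma equal_limg_lker_op0 :
  (1 < \dim {:T})%N ->
  (forall x y, x != 0 -> y != 0 -> limg (op x) = limg (op y)) ->
  (forall x y, x != 0 -> y != 0 -> lker (op x) = lker (op y)) ->
  forall x, op x = 0.
Proof.
move=> T2 eI eK x.
have [->|x0] := eqVneq x 0; first by rewrite (linear_fun0 op_linear).
have /subvPn[y _ yx] : ~~ ({:T} <= <[x]>)%VS.
  by apply: contraL T2 => /dimvS; rewrite dim_vline x0 -leqNgt.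
have nz a b : (a, b) != 0 -> a *: x + b *: y != 0.
  move=> ab; have [b0|b0] := eqVneq b 0.
    rewrite b0 in ab *; rewrite scale0r addr0 scaler_eq0 (negPf x0) orbF.
    by apply: contra ab => /eqP->.
  apply: contra yx; rewrite addrC addr_eq0 => /eqP e.
  by rewrite -(scalerK b0 y) e memvZ // memvN memvZ // memv_line.
have F a b : a *: f2mx (op x) + b *: f2mx (op y) = f2mx (op (a *: x + b *: y)).
  rewrite (linear_funD op_linear) !(linear_funZ op_linear).
  by rewrite (linear_funD f2mx_linear) !(linear_funZ f2mx_linear).
suff Z : f2mx (op x) = 0.
  by apply: val_inj; rewrite /= Z (linear_fun0 f2mx_linear).
apply/matrixP=> i j.
suff /matrixP/(_ i 0) : col j (f2mx (op x)) = 0 by rewrite !mxE.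
apply: (@surjective_pencil_kernels _ _ _ (f2mx (op x)) (f2mx (op y))) => a b ab.
  rewrite F; apply: eqmx_trans (eqmx_sym (vs2mx_limg _)) _.
  by rewrite (eI _ x) ?nz //; apply: vs2mx_limg.
move=> u; rewrite F => /sub_kermxP; rewrite -(mx2vsK (kermx _)).
rewrite -[mx2vs _]/(lker _) (eK _ x) ?nz // /lker mx2vsK => /sub_kermxP e.
by rewrite colE mulmxA e mul0mx.
Qed.

End ConstantRankFamilies.

(** * Modules over the restricted enveloping algebra *)

Section Modules.
Variables (k : fieldType) (p : nat) (charkp : p \in [pchar k]).
Variables (g : restrictedLieAlgebra charkp) (M : fdModule (renv g)).

Lemma opM_linear : linear (@opM _ _ _ _ M).
Proof. by move=> a x y; rewrite /opM renv_gen_linear linearP. Qed.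

Lemma opM_bracket x y (v : M) :
  opM M (bracket x y) v = opM M x (opM M y v) - opM M y (opM M x v).
Proof.
rewrite /opM renv_gen_bracket linearB /= !fdm_actM.
by rewrite add_lfunE opp_lfunE !comp_lfunE.
Qed.

Lemma submodule_opM (N : {vspace M}) x v :
  submodule N -> v \in N -> opM M x v \in N.
Proof. by move=> sN vN; apply: (subvP (sN _)); apply: memv_img. Qed.

Lemma opM_submodule (N : {vspace M}) :
  (forall x v, v \in N -> opM M x v \in N) -> submodule N.
Proof.
move=> opN a; apply/subvP=> _ /memv_imgP[v vN ->].
elim/renv_ind: a v vN => [||a u w IHu IHw|x u IHu] v vN.
- by rewrite linear0 zero_lfunE mem0v.
- by rewrite fdm_act1 id_lfunE.
- by rewrite linearP add_lfunE scale_lfunE memvD ?memvZ ?IHu ?IHw.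
- by rewrite fdm_actM comp_lfunE; apply: opN; apply: IHu.
Qed.

Hypothesis gp : p_trivial g.

Lemma opM_nil_representation : nil_representation (opM M).
Proof.
split=> [v a x y|x|x y v|x v].
- by rewrite opM_linear add_lfunE scale_lfunE.
- exact: linearP.
- exact: opM_bracket.
exists p.
have E i : iter i (opM M x) v = fdm_act M (renv_gen x ^+ i) v.
  elim: i => [|i IHi]; first by rewrite expr0 fdm_act1 id_lfunE.
  by rewrite iterS IHi exprS fdm_actM comp_lfunE.
rewrite E -renv_gen_ppow gp (linear_fun0 (@renv_gen_linear _ _ _ g)).
by rewrite linear0 zero_lfunE.
Qed.

Lemma fullv_subalgebra : subalgebra {:g}.
Proof. by move=> x y _ _; apply: memvf. Qed.

(** Engel on M/N gives u outside N with g u inside N. Then N + <u> is a submodule, hence equal to M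
    by maximality, and g maps it into N. *)
Lemma maximal_submodule_opM (N : {vspace M}) x v :
  maximal_submodule N -> opM M x v \in N.
Proof.
case=> sN nN maxN.
have [|||u _ [uN opu]] := engel (A := N) (B := {:M}) gp fullv_subalgebra
  opM_nil_representation (subvf N).
- by apply/negP=> le; apply: nN; apply/eqP; rewrite eqEsubv subvf.
- by move=> y w _; apply: submodule_opM.
- by move=> y w _ _; apply: memvf.
have opN y w : w \in (N + <[u]>)%VS -> opM M y w \in N.
  case/memv_addP=> w1 w1N [_ /vlineP[a ->] ->].
  by rewrite linearD linearZ /= memvD ?memvZ ?opu ?memvf // submodule_opM.
have sNu : submodule (N + <[u]>)%VS.
  by apply: opM_submodule => y w /(opN y); apply/subvP/addvSl.
have [e|e] := maxN _ sNu (addvSl _ _); last by apply: opN; rewrite e memvf.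
by rewrite -e memvE addvSr in uN.
Qed.

Lemma limg_opM_Rad x : (limg (opM M x) <= Rad M)%VS.
Proof.
apply/subvP=> _ /memv_imgP[v _ ->]; apply/memv_Rad => N.
exact: maximal_submodule_opM.
Qed.

(** Engel gives a nonzero u in N killed by g; the line <u> is a submodule, hence all of N. *)
Lemma simple_submodule_opM (N : {vspace M}) x v :
  simple_submodule N -> v \in N -> opM M x v = 0.
Proof.
case=> sN nN minN.
have [|||u uN [u0 opu]] := engel (A := 0%VS) (B := N) gp fullv_subalgebra
  opM_nil_representation (sub0v N).
- by apply/negP=> le; apply: nN; apply/eqP; rewrite -subv0.
- by move=> y w _; rewrite memv0 => /eqP->; rewrite linear0 mem0v.
- by move=> y w _; apply: submodule_opM.
have opl y w : w \in <[u]>%VS -> opM M y w = 0.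
  case/vlineP=> a ->; rewrite linearZ /=.
  by have := opu y (memvf y); rewrite memv0 => /eqP->; rewrite scaler0.
have sl : submodule <[u]>%VS.
  by apply: opM_submodule => y w /(opl y)->; rewrite mem0v.
have [|e|<-] := minN _ sl; last exact: opl.
  by rewrite -memvE.
by rewrite -e memv_line in u0.
Qed.

Lemma Soc_lker_opM x : (Soc M <= lker (opM M x))%VS.
Proof.
apply/subvP=> v /memv_Soc[s ss].
suff: (\sum_(N <- s) N <= lker (opM M x))%VS by move/subvP; apply.
rewrite big_seq; elim/big_ind: _ => [|U W sU sW|N Ns]; first exact: sub0v.
  by rewrite subv_add sU.
by apply/subvP=> u uN; rewrite memv_ker (simple_submodule_opM _ (ss _ Ns)).
Qed.

(** A proper submodule of largest dimension is maximal, and it contains the radical. *)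
Lemma dim_Rad_lt : (0 < \dim {:M})%N -> (\dim (Rad M) < \dim {:M})%N.
Proof.
move=> M0.
pose Q d := `[< exists2 N : {vspace M}, submodule N
                & \dim N = d /\ (d < \dim {:M})%N >].
have exQ : exists d, Q d.
  exists 0%N; apply/asboolP; exists 0%VS; last by rewrite dimv0.
  by move=> a; rewrite limg0.
have ubQ d : Q d -> (d <= \dim {:M})%N by move=> /asboolP[N _ [_ /ltnW]].
case: (ex_maxnP exQ ubQ) => _ /asboolP[N sN [<- ltN]] maxN.
suff mN : maximal_submodule N.
  apply: leq_ltn_trans ltN; apply: dimvS; apply/subvP=> v /memv_Rad.
  exact.
split=> // [e|N' sN' le]; first by rewrite e ltnn in ltN.
have [lt|ge] := ltnP (\dim N') (\dim {:M}); last first.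
  by right; apply/eqP; rewrite eqEdim subvf.
left; apply/esym/eqP; rewrite eqEdim le /=.
by apply: maxN; apply/asboolP; exists N'.
Qed.

(** The socle is nonzero: a nonzero vector killed by g, given by Engel, spans a simple submodule. *)
Lemma codim_Soc_lt : (0 < \dim {:M})%N -> (codimv (Soc M) < \dim {:M})%N.
Proof.
move=> M0; have [|||u _ [u0 opu]] := engel (A := 0%VS) (B := {:M}) gp
  fullv_subalgebra opM_nil_representation (sub0v _).
- by rewrite subv0 -dimv_eq0 -lt0n.
- by move=> y w _; rewrite memv0 => /eqP->; rewrite linear0 mem0v.
- by move=> y w _ _; apply: memvf.
have lineS : simple_submodule <[u]>%VS.
  split=> [|e|N sN le]; last first.
  - have [->|N0] := eqVneq N 0%VS; [by left|right; apply/eqP].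
    by rewrite eqEdim le dim_vline (leq_trans (leq_b1 _)) // lt0n dimv_eq0.
  - by rewrite -e memv_line in u0.
  apply: opM_submodule => y _ /vlineP[a ->]; rewrite linearZ /=.
  by have := opu y (memvf y); rewrite memv0 => /eqP->; rewrite scaler0 mem0v.
have uS : u \in Soc M.
  apply/memv_Soc; exists [:: <[u]>%VS]; last by rewrite big_seq1 memv_line.
  by move=> N; rewrite inE => /eqP->.
have S0 : (0 < \dim (Soc M))%N.
  by rewrite lt0n dimv_eq0; apply: contra u0 => /eqP <-.
by rewrite /codimv ltn_subrL S0.
Qed.

Lemma exists_central : (0 < \dim {:g})%N ->
  exists2 z : g, z <> 0 & forall x, bracket x z = 0.
Proof.
move=> g0; have [|||z _ [z0 cz]] := engel (A := 0%VS) (B := {:g}) gp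
  fullv_subalgebra (ad_nil_representation gp) (sub0v _).
- by rewrite subv0 -dimv_eq0 -lt0n.
- move=> x y _; rewrite memv0 => /eqP->.
  by rewrite (linear_fun0 (bracket_linearr x)) mem0v.
- by move=> x y _ _; apply: memvf.
exists z => [e|x]; first by rewrite e mem0v in z0.
by have := cz x (memvf x); rewrite memv0 => /eqP.
Qed.

Lemma opM_comm x z : bracket x z = 0 ->
  (opM M x \o opM M z)%VF = (opM M z \o opM M x)%VF.
Proof.
move=> xz; apply/lfunP=> v; rewrite !comp_lfunE; apply/eqP.
by rewrite -subr_eq0 -opM_bracket xz (linear_fun0 opM_linear) zero_lfunE.
Qed.

End Modules.

(** * Powers of commuting endomorphisms *)

Lemma lfun_exp_comm (k : fieldType) (V : vectType k) (f h : 'End(V)) j :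
  (f \o h)%VF = (h \o f)%VF ->
  (f \o lfun_exp h j)%VF = (lfun_exp h j \o f)%VF.
Proof.
move=> fh; elim: j => [|j IHj] /=; first by rewrite comp_lfun1l comp_lfun1r.
by rewrite comp_lfunA fh -comp_lfunA IHj comp_lfunA.
Qed.

Lemma lfun_expSr (k : fieldType) (V : vectType k) (f : 'End(V)) j :
  lfun_exp f j.+1 = (lfun_exp f j \o f)%VF.
Proof. exact: lfun_exp_comm. Qed.

Section EqualPowers.
Variables (k : fieldType) (V : vectType k) (f h : 'End(V)).
Hypothesis fh : (f \o h)%VF = (h \o f)%VF.

Lemma limg_exp_comm j : limg f = limg h ->
  limg (lfun_exp f j) = limg (lfun_exp h j).
Proof.
move=> e; elim: j => [//|j IHj].
rewrite /= limg_comp IHj -limg_comp lfun_exp_comm // limg_comp e -limg_comp.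
by rewrite -lfun_expSr.
Qed.

(** f^(j+1) v = 0 iff h f^j v = f^j h v = 0, iff h^j h v = 0. *)
Lemma lker_exp_comm j : lker f = lker h ->
  lker (lfun_exp f j) = lker (lfun_exp h j).
Proof.
move=> e; elim: j => [//|j IHj]; apply/vspaceP=> v.
rewrite !memv_ker (lfun_expSr h) /= !comp_lfunE -memv_ker e memv_ker.
rewrite -comp_lfunE (lfun_exp_comm j (esym fh)) comp_lfunE -memv_ker IHj.
by rewrite memv_ker.
Qed.

End EqualPowers.

Lemma dim_gt0_neq0 (k : fieldType) (V : vectType k) (x : V) :
  x <> 0 -> (0 < \dim {:V})%N.
Proof.
move=> x0; rewrite lt0n dimv_eq0; apply/negP=> /eqP V0; apply: x0.
by apply/eqP; rewrite -memv0 -V0 memvf.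
Qed.

Theorem theorem5p2 (k : closedFieldType) (p : nat) (charkp : p \in [pchar k]%R)
    (g : restrictedLieAlgebra charkp) (M : fdModule (renv g)) :
  p_trivial g -> constant_rank M ->
  [/\ (\dim (Rad M) < \dim {:g})%N -> equal_images M,
      (codimv (Soc M) < \dim {:g})%N -> equal_kernels M,
      (maxn (\dim (Rad M)) (codimv (Soc M)) < \dim {:g})%N -> trivial_module M
    & (\dim {:M} <= \dim {:g})%N -> trivial_module M].
Proof.
move=> gp cr.
have rk (x y : g) : x != 0 -> y != 0 ->
    \dim (limg (opM M x)) = \dim (limg (opM M y)).
  by move=> /eqP x0 /eqP y0; apply: cr.
have im := constant_rank_equal_limg (@opM_linear _ _ _ g M) rk
  (limg_opM_Rad M gp).
have ker := constant_rank_equal_lker (@opM_linear _ _ _ g M) rk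
  (Soc_lker_opM M gp).
have T : (maxn (\dim (Rad M)) (codimv (Soc M)) < \dim {:g})%N ->
    trivial_module M.
  rewrite gtn_max => /andP[lR lS] x m.
  (* A pencil requires dim g > 1. Otherwise the bound forces Rad(M) = 0, which contains every
     image. *)
  have [g1|g1] := leqP (\dim {:g}) 1; last first.
    rewrite (equal_limg_lker_op0 (@opM_linear _ _ _ g M) g1 (im lR) (ker lS)).
    exact: zero_lfunE.
  have := leq_trans lR g1; rewrite ltnS leqn0 dimv_eq0 => /eqP R0.
  have := subvP (limg_opM_Rad M gp x) _ (memv_img (opM M x) (memvf m)).
  by rewrite R0 memv0 => /eqP.
split=> //.
- move=> lR x y j x0 y0 _.
  have [z z0 cz] := exists_central gp (dim_gt0_neq0 x0).
  have e u : u <> 0 ->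
      limg (lfun_exp (opM M u) j) = limg (lfun_exp (opM M z) j).
    move=> u0; apply: limg_exp_comm; first exact: opM_comm.
    by apply: im => //; apply/eqP.
  by rewrite !e.
- move=> lS x y j x0 y0 _.
  have [z z0 cz] := exists_central gp (dim_gt0_neq0 x0).
  have e u : u <> 0 ->
      lker (lfun_exp (opM M u) j) = lker (lfun_exp (opM M z) j).
    move=> u0; apply: lker_exp_comm; first exact: opM_comm.
    by apply: ker => //; apply/eqP.
  by rewrite !e.
(* The zero module is set apart, since its radical is not proper. For M nonzero both dimensions in
   (3) are less than dim M. *)
move=> le x m; have [M0|M0] := posnP (\dim {:M}).
  have : opM M x m \in {:M}%VS by apply: memvf.
  by move/eqP: M0; rewrite dimv_eq0 => /eqP ->; rewrite memv0 => /eqP.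
apply: T; apply: leq_trans le.
by rewrite gtn_max dim_Rad_lt // codim_Soc_lt.
Qed.
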